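(* Let $X$ be a real random variable with $X>0$, having an arbitrary probability distribution $p_X$ on $(0,\infty)$, and let $Y$ be an integer random variable with values in $\mathbb{N}=\{0,1,2,\dots\}$ whose conditional distribution given $X=x$ is the Poisson distribution $$p_{Y|X}(Y=n\mid x)=\frac{x^n}{n!}e^{-x},\qquad \forall n\in\mathbb{N},\ x>0 .$$ Then there is a (possibly nonconvex) proper penalty function $\tilde\varphi_X:(0,\infty)\to\mathbb{R}\cup\{+\infty\}$, depending on the probability distribution $p_X$ of $X$, such that for any $n\in\mathbb{N}$ $$\mathbb{E}(X\mid Y=n)\in\arg\min_{x>0}\left\{\tfrac12(n-x)^2+\tilde\varphi_X(x)\right\}.$$
   Context: A function with values in $\mathbb{R}\cup\{+\infty\}$ is proper if it is not identically $+\infty$. The conditional expectation is given for every $n\in\mathbb{N}$ by $$\mathbb{E}(X\mid Y=n)=\frac{\mathbb{E}_X\left(X\cdot X^n e^{-X}/n!\right)}{\mathbb{E}_X\left(X^n e^{-X}/n!\right)}.$$ *)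

(* Defs.v *)
From HB Require Import structures.
From mathcomp Require Import all_boot all_order all_algebra.
From mathcomp Require Import all_classical all_reals all_analysis.

Set Implicit Arguments.
Unset Strict Implicit.
Unset Printing Implicit Defensive.

Import Order.TTheory GRing.Theory Num.Theory.
Import numFieldNormedType.Exports.

Local Open Scope classical_set_scope.
Local Open Scope ring_scope.

(* The law of [X] is [mu].  Agreement is required on measurable sets only:
   the values of a library measure on other sets carry no information. *)
Definition has_law d d' (Omega : measurableType d) (T : measurableType d')
    (R : realType) (P : probability Omega R) (X : {RV P >-> T})
    (mu : probability T R) : Prop :=
  forall A : set T, measurable A -> distribution P X A = mu A.

(* [p x] is a version of the conditional probability mass function of [Y]
   given [X = x] (disintegration along the law of [X]); the values of [p] on
   a null set for the law of [X] are irrelevant. *)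
Definition has_cond_pmf d d' (Omega : measurableType d) (T : measurableType d')
    (R : realType) (P : probability Omega R) (X : {RV P >-> T})
    (Y : {RV P >-> nat}) (p : T -> nat -> R) : Prop :=
  forall (A : set T) (n : nat), measurable A ->
    P (X @^-1` A `&` Y @^-1` [set n])
    = (\int[distribution P X]_(x in A) (p x n)%:E)%E.

(* E(X | E) = E(X 1_E) / P(E).  The integral is real-valued ([fine] of the
   extended one), so this is meaningful when [X] is integrable on [E] and
   [P E] is nonzero. *)
Definition cond_expectation d (Omega : measurableType d) (R : realType)
    (P : probability Omega R) (X : {RV P >-> measurableTypeR R})
    (E : set Omega) : R :=
  (\int[P]_(w in E) (X w : R)) / fine (P E).

(* [f], restricted to [D], takes values in R U {+oo} and is not identically
   +oo. *)
Definition proper_on (T : Type) (R : realType) (D : set T)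
    (f : T -> \bar R) : Prop :=
  (forall x, D x -> f x != -oo%E) /\ (exists2 x, D x & f x != +oo%E).

Definition argmin (T : Type) (R : realType) (D : set T) (f : T -> \bar R) :
    set T :=
  [set x | D x /\ forall y, D y -> (f x <= f y)%E].

(* Main.v *)
Require Import Defs.
From HB Require Import structures.
From mathcomp Require Import all_boot all_order all_algebra.
From mathcomp Require Import all_classical all_reals all_analysis.
From mathcomp Require Import measurable_realfun ring.

(* Bayes' formula gives [E(X | Y = n) = m n := M n.+1 / M n], where [M n] is
   the integral of [x^n exp(-x)] against the law of [X]; the sequence [M] is
   log-convex, so [m] is nondecreasing.  Take
     [phi x := sup_k \sum_(i < k) (x - m i) - x^2 / 2].
   Keeping only the term [k = n] of the supremum bounds the [n]-th objective
   from below by [n^2 / 2 - \sum_(i < n) m i], which does not depend on [x],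
   and by monotonicity of [m] the supremum at [x = m n] is attained at
   [k = n], so that the bound is reached there. *)

Import Order.TTheory GRing.Theory Num.Theory.
Import numFieldNormedType.Exports.

Local Open Scope classical_set_scope.
Local Open Scope ring_scope.

Set Implicit Arguments.

(** * General facts on integrals *)

(** Lets integrals over the whole line, or over an event, be cut down to the region where [X] is
    positive. *)
Lemma integral_setI_conull (d : measure_display) (T : measurableType d)
    (R : realType) (mu : {measure set T -> \bar R}) (D B : set T)
    (f : T -> \bar R) :
  measurable D -> measurable B -> measurable_fun D f -> mu (~` B) = 0%E ->
  (\int[mu]_(x in D) f x = \int[mu]_(x in D `&` B) f x)%E.
Proof.
move=> mD mB mf muB0; rewrite integral_mkcondr.
apply: ae_eq_integral => //.
  by apply/measurable_restrict => //; apply: (measurable_funS mD _ mf).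
exists (~` B); split => //; first exact: measurableC.
move=> t /= + Bt; apply=> Dt.
by rewrite patchE mem_set.
Qed.

(** A zero integral would force [f] to vanish almost everywhere on [D]; since [f] vanishes nowhere
    on [D], all of [D] would be null. *)
Lemma Rintegral_gt0 (d : measure_display) (T : measurableType d)
    (R : realType) (mu : {measure set T -> \bar R}) (D : set T) (f : T -> R) :
  measurable D -> mu D != 0%E -> mu.-integrable D (EFin \o f) ->
  (forall x, D x -> 0 < f x) -> 0 < \int[mu]_(x in D) f x.
Proof.
move=> mD muD0 fi f0; rewrite lt_neqAle Rintegral_ge0 ?andbT; last first.
  by move=> x /f0/ltW.
apply: contra_neqN muD0 => /eqP int0.
have /ae_eq_integral_abs : (\int[mu]_(x in D) `|(EFin \o f) x| = 0)%E.
  rewrite (eq_integral (EFin \o f)); last first.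
    by move=> x /set_mem /f0 fx0; rewrite /= gtr0_norm.
  by rewrite -[LHS]fineK ?integrable_fin_num// -[fine _]int0.
case/(_ mD (measurable_int mu fi)) => N [mN muN0 DN].
apply: (subset_measure0 mD mN _ muN0).
apply: subset_trans DN => x Dx /= /(_ Dx) [fx0].
by have := f0 x Dx; rewrite fx0 ltxx.
Qed.

Section density.
Import HBNNSimple.

(** Monotone convergence along simple approximations of [f] reduces the claim to simple functions,
    and linearity reduces it further to indicators, where it is the assumed formula for [nu]. *)
Lemma ge0_integral_density (d : measure_display) (T : measurableType d)
    (R : realType) (mu nu : {measure set T -> \bar R}) (D : set T)
    (g : T -> R) (f : T -> \bar R) :
  measurable D -> measurable_fun D g -> (forall x, D x -> 0 <= g x) ->
  (forall A, measurable A -> A `<=` D ->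
    nu A = \int[mu]_(x in A) (g x)%:E)%E ->
  measurable_fun D f -> (forall x, D x -> 0 <= f x)%E ->
  (\int[nu]_(x in D) f x = \int[mu]_(x in D) (f x * (g x)%:E))%E.
Proof.
move=> mD mg g0 nuE mf f0.
pose h := nnsfun_approx mD mf.
have cvg_h x : D x -> (EFin \o (fun n => h n x)) @ \oo --> f x.
  by move=> Dx; apply: cvg_nnsfun_approx.
have nd_h x : {homo (fun n => h n x) : a b / (a <= b)%N >-> a <= b}.
  by move=> a b ab; exact/lefP/nd_nnsfun_approx.
have -> : (\int[nu]_(x in D) f x =
    limn (fun n => \int[nu]_(x in D) (h n x)%:E))%E.
  rewrite -monotone_convergence//.
  - by apply: eq_integral => x /set_mem Dx; apply/esym/cvg_lim => //; exact: cvg_h.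
  - by move=> n; apply/measurable_EFinP/measurable_funTS.
  - by move=> n x _; rewrite lee_fin.
  - by move=> x _ a b ab; rewrite lee_fin; exact: nd_h.
have -> : (\int[mu]_(x in D) (f x * (g x)%:E) =
    limn (fun n => \int[mu]_(x in D) ((h n x)%:E * (g x)%:E)))%E.
  rewrite -monotone_convergence//.
  - apply: eq_integral => x /set_mem Dx; apply/esym/cvg_lim => //.
    by apply: cvgeZr => //; exact: cvg_h.
  - move=> n; apply: emeasurable_funM; last exact/measurable_EFinP.
    exact/measurable_EFinP/measurable_funTS.
  - by move=> n x Dx; rewrite mule_ge0 ?lee_fin// g0.
  - move=> x Dx a b ab; rewrite lee_wpmul2r ?lee_fin ?g0//; exact: nd_h.
congr (limn _); apply/funext => n.
(* Splitting [h n] over its finite range leaves one level set at a time. *)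
have hE x : ((h n x)%:E = \sum_(y \in range (h n))
    (y * \1_(h n @^-1` [set y]) x)%:E)%E by rewrite fimfunE -fsumEFin.
under eq_integral do rewrite hE.
rewrite ge0_integral_fsum//; last 2 first.
- by move=> y; apply/measurable_EFinP/measurable_funTS/measurable_funM.
- by move=> y x _; rewrite nnfun_muleindic_ge0.
under [RHS]eq_integral => x xD.
  rewrite hE ge0_mule_fsuml; last by move=> y; exact: nnfun_muleindic_ge0.
  over.
rewrite /= ge0_integral_fsum//; last 2 first.
- move=> y; apply: emeasurable_funM; last exact/measurable_EFinP.
  by apply/measurable_EFinP/measurable_funTS/measurable_funM.
- by move=> y x Dx; rewrite mule_ge0 ?nnfun_muleindic_ge0 ?lee_fin ?g0.
apply: eq_fsbigr => r /set_mem [t _ ht].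
have r0 : 0 <= r by rewrite -ht.
under eq_integral do rewrite EFinM.
under [RHS]eq_integral do rewrite EFinM -muleA.
have mB : measurable (h n @^-1` [set r]) by exact: measurable_sfunP.
rewrite ge0_integralZl//; last first.
  by apply/measurable_EFinP/measurable_funTS.
rewrite ge0_integralZl//; last 2 first.
- apply: emeasurable_funM; last exact/measurable_EFinP.
  by apply/measurable_EFinP/measurable_funTS.
- by move=> x Dx; rewrite mule_ge0 ?lee_fin ?g0.
congr (_ * _)%E.
rewrite integral_indic// nuE//; last exact: measurableI.
under [RHS]eq_integral do rewrite muleC.
rewrite [RHS](eq_integral ((EFin \o g) \_ (h n @^-1` [set r]))%E); last first.
  by move=> x _; rewrite epatch_indic.
by rewrite -integral_mkcondr setIC.
Qed.

End density.

(** * Poisson moments and the posterior mean *)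

(** The Poisson weight without its factor [1 / n!], which is common to the numerator and denominator
    of Bayes' formula and cancels there. *)
Definition poisson_moment (R : realType)
    (mu : {measure set (measurableTypeR R) -> \bar R}) (n : nat) : R :=
  \int[mu]_(x in `]0, +oo[) ((x : R) ^+ n * expR (- x)).

Definition posterior_mean (R : realType)
    (mu : {measure set (measurableTypeR R) -> \bar R}) (n : nat) : R :=
  poisson_moment mu n.+1 / poisson_moment mu n.

(** For [x >= 0], [x^n / n!] is a single term of the exponential series. The bound makes the weights
    integrable against any finite measure. *)
Lemma exprn_expRN_le_fact (R : realType) (n : nat) (x : R) :
  0 <= x -> x ^+ n * expR (- x) <= n`!%:R.
Proof.
move=> x0; rewrite expRN ler_pdivrMr ?expR_gt0// mulrC -ler_pdivrMr; last first.
  by rewrite ltr0n fact_gt0.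
case: n => [|n]; first by rewrite expr0 fact0 divr1 -expR0 ler_expR.
by apply: le_trans (expR_ge1Dxn n x0); rewrite lerDr.
Qed.

Lemma measurable_exprn_expRN (R : realType) (n : nat) (D : set R) :
  measurable_fun D (fun x : R => x ^+ n * expR (- x)).
Proof.
apply: measurable_funTS; apply: measurable_funM; first exact: measurable_funX.
by apply: measurableT_comp; first exact: measurable_expR.
Qed.

Lemma integrable_exprn_expRN (R : realType)
    (mu : {finite_measure set (measurableTypeR R) -> \bar R}) (n : nat) :
  mu.-integrable `]0, +oo[%classic (EFin \o (fun x : R => x ^+ n * expR (- x))).
Proof.
apply: measurable_bounded_integrable => //.
- by rewrite ltey_eq fin_num_measure.
- exact: measurable_exprn_expRN.
- exists n`!%:R; split; first exact: num_real.
  move=> M ltM x; rewrite /= in_itv/= andbT => x0.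
  rewrite ger0_norm; last by rewrite mulr_ge0 ?expR_ge0// exprn_ge0// ltW.
  by apply: le_trans (ltW ltM); exact/exprn_expRN_le_fact/ltW.
Qed.

Lemma poisson_moment_gt0 (R : realType)
    (mu : {finite_measure set (measurableTypeR R) -> \bar R}) (n : nat) :
  mu `]0, +oo[%classic != 0%E -> 0 < poisson_moment mu n.
Proof.
move=> mu0; apply: Rintegral_gt0 => //; first exact: integrable_exprn_expRN.
by move=> x; rewrite /= in_itv/= andbT => x0; rewrite mulr_gt0 ?expR_gt0 ?exprn_gt0.
Qed.

(* Expanding the nonnegative integral of [(x - m)^2 x^n exp(-x)] at
   [m = posterior_mean mu n] gives the log-convexity of the moments. *)
Lemma posterior_mean_nondecreasing (R : realType)
    (mu : {finite_measure set (measurableTypeR R) -> \bar R}) :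
  mu `]0, +oo[%classic != 0%E ->
  {homo posterior_mean mu : i j / (i <= j)%N >-> i <= j}.
Proof.
move=> mu0; apply: (homo_leq (@lexx _ R) (@le_trans _ R)) => n.
have M0 k : 0 < poisson_moment mu k by exact: poisson_moment_gt0.
set m := posterior_mean mu n.
have mpos : measurable (`]0, +oo[%classic : set (measurableTypeR R)) by [].
have intw k := integrable_exprn_expRN mu k.
have intZ k (c : R) : mu.-integrable `]0, +oo[%classic
    (EFin \o (fun x : R => c * (x ^+ k * expR (- x)))).
  by apply: eq_integrable (integrableZl _ c (intw k)).
have RintZ k (c : R) : \int[mu]_(x in `]0, +oo[)
    (c * ((x : R) ^+ k * expR (- x))) = c * poisson_moment mu k.
  exact: RintegralZl mpos (intw k).
pose w k (x : R) := x ^+ k * expR (- x).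
have : 0 <= \int[mu]_(x in `]0, +oo[)
    (w n.+2 x + m ^+ 2 * w n x - (2 * m) * w n.+1 x).
  apply: Rintegral_ge0 => x; rewrite /= in_itv/= andbT => x0.
  rewrite (_ : _ - _ = (x - m) ^+ 2 * w n x); last by rewrite /w !exprS; ring.
  by rewrite mulr_ge0 ?sqr_ge0// mulr_ge0 ?expR_ge0 ?exprn_ge0// ltW.
have -> : \int[mu]_(x in `]0, +oo[)
    (w n.+2 x + m ^+ 2 * w n x - (2 * m) * w n.+1 x) =
    poisson_moment mu n.+2 + m ^+ 2 * poisson_moment mu n
    - 2 * m * poisson_moment mu n.+1.
  have intD : mu.-integrable `]0, +oo[%classic
      (EFin \o (fun x : R => w n.+2 x + m ^+ 2 * w n x)).
    by apply: eq_integrable (integrableD _ (intw n.+2) (intZ n (m ^+ 2))).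
  apply: etrans (RintegralB mpos intD (intZ n.+1 (2 * m))) _.
  congr (_ - _); last exact: RintZ.
  apply: etrans (RintegralD mpos (intw n.+2) (intZ n (m ^+ 2))) _.
  by congr (_ + _); exact: RintZ.
(* After this substitution the expansion collapses to [M n.+2 - m^2 * M n], and [m^2 * M n] is
   [m * M n.+1], as the goal requires. *)
have -> : poisson_moment mu n.+1 = m * poisson_moment mu n.
  by rewrite /m /posterior_mean divfK// gt_eqF.
rewrite /posterior_mean ler_pdivlMr// => h.
have -> : poisson_moment mu n.+1 = m * poisson_moment mu n.
  by rewrite /m /posterior_mean divfK// gt_eqF.
rewrite -subr_ge0; apply: le_trans h _; rewrite le_eqVlt; apply/orP; left.
by apply/eqP; ring.
Qed.

(** * Bayes' formula for Poisson observations *)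

Section conditional.
Context (R : realType) (pX : probability (measurableTypeR R) R)
  (pX_pos : pX `]0, +oo[%classic = 1%E) (d : measure_display)
  (Omega : measurableType d) (P : probability Omega R)
  (X : {RV P >-> measurableTypeR R}) (Y : {RV P >-> nat})
  (lawX : has_law X pX)
  (pmfY : has_cond_pmf X Y (fun (x : R) (n : nat) =>
     x ^+ n / n`!%:R * expR (- x))).

Local Lemma has_law_conull : pX (~` `]0, +oo[%classic) = 0%E.
Proof. by rewrite probability_setC// pX_pos subee. Qed.

Local Lemma measurable_fiber (n : nat) : measurable (Y @^-1` [set n]).
Proof. exact: measurable_funPTI. Qed.

Local Lemma cond_pmf_law (n : nat) (A : set (measurableTypeR R)) :
  measurable A ->
  (P (X @^-1` A `&` Y @^-1` [set n]) =
   \int[pX]_(x in A) (n`!%:R^-1 * ((x : R) ^+ n * expR (- x)))%:E)%E.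
Proof.
move=> mA; rewrite pmfY// (eq_measure_integral pX); last first.
  by move=> B mB _; exact: lawX.
by apply: eq_integral => x _; congr (_%:E); ring.
Qed.

(** The denominator of Bayes' formula: the conditional mass function is integrated over the whole
    line, whose nonpositive part is null for [pX]. *)
Lemma prob_fiber (n : nat) :
  fine (P (Y @^-1` [set n])) = n`!%:R^-1 * poisson_moment pX n.
Proof.
have -> : Y @^-1` [set n] = X @^-1` setT `&` Y @^-1` [set n].
  by rewrite preimage_setT setTI.
have mpos : measurable (`]0, +oo[%classic : set (measurableTypeR R)) by [].
rewrite cond_pmf_law// (integral_setI_conull pX _ measurableT mpos); last 2 first.
- apply/measurable_EFinP; apply: measurable_funM => //.
  exact: measurable_exprn_expRN.
- exact: has_law_conull.
by rewrite setTI; exact: RintegralZl mpos (integrable_exprn_expRN _ _).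
Qed.

(** The numerator of Bayes' formula: the measure [A |-> P (X in A, Y = n)] has density
    [x^n exp(-x) / n!] with respect to [pX], and the extra factor [X] raises the exponent by one. *)
Lemma Rintegral_fiber (n : nat) :
  \int[P]_(w in Y @^-1` [set n]) (X w : R) =
  n`!%:R^-1 * poisson_moment pX n.+1.
Proof.
set E := Y @^-1` [set n].
have mE : measurable E := measurable_fiber n.
have mpos : measurable (`]0, +oo[%classic : set (measurableTypeR R)) by [].
have mB : measurable (X @^-1` `]0, +oo[%classic) by exact: measurable_funPTI.
have mX : measurable_fun setT (X : Omega -> measurableTypeR R) by [].
rewrite /Rintegral (integral_setI_conull P _ mE mB); last 2 first.
- by apply/measurable_EFinP/measurable_funTS.
- rewrite preimage_setC.
  by rewrite -[LHS]/(distribution P X _) lawX ?has_law_conull//; exact: measurableC.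
(* Moving the event [Y = n] from the domain into the measure leaves a preimage under [X] as domain,
   so the integral can be pushed forward along [X]. *)
pose PE := mrestr P mE.
have -> : (\int[P]_(w in E `&` X @^-1` `]0%R, +oo[%classic) (X w : R)%:E =
    \int[PE]_(w in X @^-1` `]0%R, +oo[%classic) (X w : R)%:E)%E.
  (* The complement of [E] is null for [PE], and [PE] agrees with [P] on subsets of [E]. *)
  rewrite (ge0_negligible_integral (measurableC mE) mB)//.
  - rewrite setDE setCK setIC; apply: eq_measure_integral => A mA AE.
    by rewrite /= /mrestr setIidl// => w /AE[].
  - by apply/measurable_EFinP/measurable_funTS.
  - by move=> w /=; rewrite in_itv/= andbT lee_fin => /ltW.
  - by rewrite /= /mrestr setICl measure0.
rewrite -[LHS]/(fine (\int[PE]_(w in X @^-1` `]0%R, +oo[%classic)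
  ((fun x : R => x%:E) \o X) w)%E).
rewrite -(ge0_integral_pushforward mX)//; last 2 first.
- by apply/measurable_EFinP.
- by move=> x; rewrite inE/= in_itv/= andbT lee_fin => /ltW.
rewrite (@ge0_integral_density _ _ _ pX _ _
  (fun x : R => n`!%:R^-1 * (x ^+ n * expR (- x))))//.
- apply: etrans (RintegralZl _ mpos (integrable_exprn_expRN _ _)).
  rewrite /Rintegral; congr fine; apply: eq_integral => x _.
  by rewrite -EFinM; congr (_%:E); rewrite exprS; ring.
- by apply: measurable_funM => //; exact: measurable_exprn_expRN.
- move=> x; rewrite /= in_itv/= andbT => x0.
  by rewrite !mulr_ge0 ?invr_ge0 ?expR_ge0 ?exprn_ge0// ltW.
- by move=> A mA _; rewrite -cond_pmf_law.
- by move=> x; rewrite /= in_itv/= andbT lee_fin => /ltW.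
Qed.

Lemma cond_expectation_poisson (n : nat) :
  cond_expectation X (Y @^-1` [set n]) = posterior_mean pX n.
Proof.
rewrite /cond_expectation prob_fiber Rintegral_fiber.
by rewrite -mulf_div divff ?mul1r// invr_eq0 pnatr_eq0 -lt0n fact_gt0.
Qed.

End conditional.

(** * The penalty and its minimizers *)

(** The summand is nonnegative for [i <= n] and nonpositive for [i >= n], so the partial sums peak
    at length [n]. *)
Lemma sum_sub_nondecreasing_le (R : realType) (m : nat -> R) (n k : nat) :
  {homo m : i j / (i <= j)%N >-> i <= j} ->
  \sum_(i < k) (m n - m i) <= \sum_(i < n) (m n - m i).
Proof.
move=> m_nd; rewrite -!(big_mkord xpredT (fun i => m n - m i)).
case: (leqP k n) => [kn|/ltnW nk].
  rewrite [leRHS](big_cat_nat _ kn)//= lerDl big_nat sumr_ge0// => i /andP[_ ltin].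
  by rewrite subr_ge0 m_nd// ltnW.
rewrite [leLHS](big_cat_nat _ nk)//= gerDl big_nat sumr_le0// => i /andP[leni _].
by rewrite subr_le0 m_nd.
Qed.

Unset Implicit Arguments.

Theorem proposition1 (R : realType) (pX : probability (measurableTypeR R) R)
    (pX_pos : pX `]0, +oo[%classic = 1%E) :
  exists phi : R -> \bar R,
    proper_on `]0, +oo[%classic phi /\
    forall (d : measure_display) (Omega : measurableType d)
      (P : probability Omega R)
      (X : {RV P >-> measurableTypeR R}) (Y : {RV P >-> nat}),
      has_law X pX ->
      has_cond_pmf X Y (fun (x : R) (n : nat) => x ^+ n / n`!%:R * expR (- x)) ->
      forall n : nat,
        cond_expectation X (Y @^-1` [set n])
        \in argmin `]0, +oo[%classic
              (fun x : R => ((2^-1 * (n%:R - x) ^+ 2)%:E + phi x)%E).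
Proof.
have pX0 : pX `]0, +oo[%classic != 0%E by rewrite pX_pos onee_neq0.
pose m := posterior_mean pX.
have m_nd := posterior_mean_nondecreasing _ pX0.
have m_gt0 n : 0 < m n by rewrite divr_gt0// poisson_moment_gt0.
pose a k x : R := \sum_(i < k) (x - m i) - 2^-1 * x ^+ 2.
pose phi x := ereal_sup (range (fun k => (a k x)%:E)).
have a_le_phi k x : ((a k x)%:E <= phi x)%E.
  by apply: ereal_sup_ubound; exists k.
have phi_m n : phi (m n) = (a n (m n))%:E.
  apply/eqP; rewrite eq_le a_le_phi andbT; apply: ge_ereal_sup => _ [k _ <-].
  by rewrite lee_fin lerD2r; exact: sum_sub_nondecreasing_le.
exists phi; split.
  (* The term [k = 0], equal to [- x^2 / 2], keeps [phi] above [-oo]; at [m 0] the supremum is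
     attained, hence finite. *)
  split=> [x _|]; first by rewrite -ltNye (lt_le_trans _ (a_le_phi 0%N x))// ltNyr.
  by exists (m 0%N); rewrite /= ?in_itv/= ?m_gt0// phi_m.
move=> d Omega P X Y lawX pmfY n.
rewrite (cond_expectation_poisson pX_pos lawX pmfY) inE; split.
  by rewrite /= in_itv/= m_gt0.
move=> y _; rewrite phi_m.
apply: (@le_trans _ _ ((2^-1 * (n%:R - y) ^+ 2)%:E + (a n y)%:E)%E); last first.
  by rewrite leeD2l.
(* The sum in [a n] has slope [n], which cancels the cross term [- n * x] of the square; the
   quadratic terms cancel as well. *)
have aE x : 2^-1 * (n%:R - x) ^+ 2 + a n x =
    2^-1 * n%:R ^+ 2 - \sum_(i < n) m i.
  by rewrite /a sumrB sumr_const card_ord -mulr_natl; field.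
by rewrite -!EFinD !aE.
Qed.
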